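(* Let $\alpha_0,\alpha_1,\alpha_2\in\mathbb{C}$ with $\alpha_0+2\alpha_1+2\alpha_2=1$, and consider the Hamiltonian system $$\frac{dx}{dt}=\frac{\partial H}{\partial y},\quad \frac{dy}{dt}=-\frac{\partial H}{\partial x},\quad \frac{dz}{dt}=\frac{\partial H}{\partial w},\quad \frac{dw}{dt}=-\frac{\partial H}{\partial z}$$ with $$H=2xy^2+2x^2+2tx-2\alpha_1 y+z^2w-\frac{w^2}{2}+\alpha_0 z+xw+2yzw .$$ This system has the following invariant divisors: if $\alpha_0=0$, then $f_0:=w$ is an invariant divisor; if $\alpha_1=0$, then $f_1:=x+z^2$ is an invariant divisor; if $\alpha_2=0$, then $f_2:=x+y^2+w+t$ is an invariant divisor.
   Context: A polynomial $f\in\mathbb{C}(t)[x,y,z,w]$ is called an invariant divisor of the system if its total derivative along the system, $\frac{df}{dt}=\frac{\partial f}{\partial t}+\frac{\partial f}{\partial x}\frac{dx}{dt}+\frac{\partial f}{\partial y}\frac{dy}{dt}+\frac{\partial f}{\partial z}\frac{dz}{dt}+\frac{\partial f}{\partial w}\frac{dw}{dt}$, is divisible by $f$ in $\mathbb{C}(t)[x,y,z,w]$ (so that $\{f=0\}$ is preserved by the flow). *)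

(* Defs.v *)
From HB Require Import structures.
From mathcomp Require Import all_boot all_order all_algebra.
From mathcomp Require Import generic_quotient fraction.
From mathcomp Require Import reals complex.
From mathcomp Require Import mpoly.
From mathcomp Require Import ring.

Set Implicit Arguments.
Unset Strict Implicit.
Unset Printing Implicit Defensive.

Import GRing.Theory.
Local Open Scope ring_scope.
Local Open Scope quotient_scope.

Notation "x %:F" := (FracField.tofrac x) : ring_scope.

Section RationalFunctions.
Variable F : fieldType.
Implicit Types (p q : {poly F}) (a : {fraction {poly F}}).

(* The quotient rule, applied to the canonical representative of a; by        *)
(* ratfun_derivE any other representative gives the same value.               *)
Definition ratfun_deriv a : {fraction {poly F}} :=
  let r := repr a in
  ((\n_r)^`() * \d_r - \n_r * (\d_r)^`())%:F / (\d_r ^+ 2)%:F.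

Lemma ratfun_derivE p q : q != 0 ->
  ratfun_deriv (p%:F / q%:F) = (p^`() * q - p * q^`())%:F / (q ^+ 2)%:F.
Proof.
move=> q0; rewrite /ratfun_deriv.
set a : {fraction {poly F}} := p%:F / q%:F; set r := repr a.
have d0 : \d_r != 0 by exact: denom_ratioP.
have ra : a * (\d_r)%:F = (\n_r)%:F.
  rewrite -[a]reprK -/r; unlock FracField.tofrac.
  rewrite -[LHS]FracField.pi_mul; apply/eqmodP.
  rewrite /= FracField.equivfE /FracField.mulf.
  by rewrite !(numden_Ratio, mulr1, oner_neq0) // mulrC.
have E : p * \d_r = \n_r * q.
  apply/eqP; rewrite -tofrac_eq !tofracM -ra /a; apply/eqP.
  by rewrite mulrAC divfK // tofrac_eq0.
have E' : p^`() * \d_r + p * (\d_r)^`() = (\n_r)^`() * q + \n_r * q^`().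
  by rewrite -!derivM E.
apply/eqP; rewrite eqr_div ?tofrac_eq0 ?expf_neq0 // -!tofracM tofrac_eq.
move: E E'; set n := \n_r; set d := \d_r.
set n' := n^`(); set d' := d^`(); set p' := p^`(); set q' := q^`() => E E'.
apply/eqP.
have -> : (n' * d - n * d') * q ^+ 2 =
  d * q * (n' * q + n * q') - d * q' * (n * q) - q * d' * (n * q) by ring.
by rewrite -E' -E; ring.
Qed.

End RationalFunctions.

(* F(t)[x,y,z,w]; the indices 0, 1, 2, 3 are x, y, z, w. *)
Notation phase_poly F := {mpoly {fraction {poly F}}[4]}.

Definition ix : 'I_4 := @Ordinal 4 0 isT.
Definition iy : 'I_4 := @Ordinal 4 1 isT.
Definition iz : 'I_4 := @Ordinal 4 2 isT.
Definition iw : 'I_4 := @Ordinal 4 3 isT.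

Section HamiltonianSystem.
Variable F : fieldType.
Implicit Types f H : phase_poly F.

Definition var_x : phase_poly F := 'X_ix.
Definition var_y : phase_poly F := 'X_iy.
Definition var_z : phase_poly F := 'X_iz.
Definition var_w : phase_poly F := 'X_iw.
Definition time_t : phase_poly F := ('X%:F)%:MP.
Definition const (c : F) : phase_poly F := ((c%:P)%:F)%:MP.

Definition time_deriv f : phase_poly F := map_mpoly (@ratfun_deriv F) f.

Definition hamiltonian_field H : 'I_4 -> phase_poly F :=
  tnth [tuple H^`M(iy); - H^`M(ix); H^`M(iw); - H^`M(iz)].

Definition total_deriv (v : 'I_4 -> phase_poly F) f : phase_poly F :=
  time_deriv f + \sum_(i < 4) f^`M(i) * v i.

Definition invariant_divisor (v : 'I_4 -> phase_poly F) f : Prop :=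
  exists g : phase_poly F, total_deriv v f = g * f.

Definition hamiltonian (a0 a1 : F) : phase_poly F :=
  let x := var_x in let y := var_y in let z := var_z in let w := var_w in
  let t := time_t in
  2 * x * y ^+ 2 + 2 * x ^+ 2 + 2 * t * x - 2 * const a1 * y
  + z ^+ 2 * w - const 2^-1 * w ^+ 2 + const a0 * z + x * w + 2 * y * z * w.

End HamiltonianSystem.

(* Main.v *)
(* Along a Hamiltonian flow df/dt = d_t f + {f, H}.  Expanding the bracket gives
     {w, H}               = - (2y + 2z) w - a0,
     {x + z^2, H}         = (4y + 2z) (x + z^2) - 2 a1,
     {x + y^2 + w + t, H} = - 4y (x + y^2 + w + t) - (a0 + 2 a1),
   where d_t vanishes on the first two polynomials and is 1 on the third.  Each
   remainder disappears when the corresponding parameter is zero; in the third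
   case because 1 - (a0 + 2 a1) = 2 a2. *)

Require Import Defs.
From HB Require Import structures.
From mathcomp Require Import all_boot all_order all_algebra.
From mathcomp Require Import generic_quotient fraction.
From mathcomp Require Import reals complex.
From mathcomp Require Import mpoly.
From mathcomp Require Import ring.

Set Implicit Arguments.
Unset Strict Implicit.
Unset Printing Implicit Defensive.

Import GRing.Theory.
Local Open Scope ring_scope.
Local Open Scope quotient_scope.

(** With [D] an arbitrary derivation, one expansion serves all four partial derivatives. The
    coefficient 1/2 is a symbol [h] killed by [D], so the identity needs no division. *)
Lemma derivation_hamiltonian (A : comNzRingType) (D : {additive A -> A})
    (x y z w t h a0 a1 : A) :
    (forall p q, D (p * q) = D p * q + p * D q) ->
    D t = 0 -> D h = 0 -> D a0 = 0 -> D a1 = 0 ->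
  D (2 * x * y ^+ 2 + 2 * x ^+ 2 + 2 * t * x - 2 * a1 * y
     + z ^+ 2 * w - h * w ^+ 2 + a0 * z + x * w + 2 * y * z * w) =
  D x * (2 * y ^+ 2 + 4 * x + 2 * t + w)
  + D y * (4 * x * y - 2 * a1 + 2 * z * w)
  + D z * (2 * z * w + a0 + 2 * y * w)
  + D w * (z ^+ 2 - 2 * h * w + x + 2 * y * z).
Proof.
(* Numerals become natural multiples, with which every additive map commutes. *)
move=> DM Dt Dh Da0 Da1; rewrite !expr2 -!mulrA !mulr_natl.
by rewrite !(raddfD D, raddfN D, raddfMn D, DM) Dt Dh Da0 Da1; ring.
Qed.

(* The coefficient ring is abstract because over {fraction {poly F}} failed
   unifications unfold the quotient type and rewriting becomes intractable. *)
Section GenericCoefficients.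
Variable S : comNzRingType.
Variables t h a0 a1 : S.
Hypothesis h_half : 2 * h = 1.
Implicit Types f g : {mpoly S[4]}.
Let x : {mpoly S[4]} := 'X_ix.
Let y : {mpoly S[4]} := 'X_iy.
Let z : {mpoly S[4]} := 'X_iz.
Let w : {mpoly S[4]} := 'X_iw.
Let H : {mpoly S[4]} :=
  2 * x * y ^+ 2 + 2 * x ^+ 2 + 2 * t%:MP * x - 2 * a1%:MP * y
  + z ^+ 2 * w - h%:MP * w ^+ 2 + a0%:MP * z + x * w + 2 * y * z * w.

Lemma mderiv_var (i j : 'I_4) : ('X_i : {mpoly S[4]})^`M(j) = (i == j)%:R.
Proof.
rewrite mderivX mnm1E; case: eqP => [->|_]; last by rewrite scale0r.
by rewrite scale1r -{1}[U_(j)%MM]add0m addmK mpolyX0.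
Qed.

Lemma mderiv_hamiltonian i :
  H^`M(i) =
  (ix == i)%:R * (2 * y ^+ 2 + 4 * x + 2 * t%:MP + w)
  + (iy == i)%:R * (4 * x * y - 2 * a1%:MP + 2 * z * w)
  + (iz == i)%:R * (2 * z * w + a0%:MP + 2 * y * w)
  + (iw == i)%:R * (z ^+ 2 - w + x + 2 * y * z).
Proof.
have two_h : 2 * h%:MP_[4] = 1 by rewrite mulr_natl -mpolyCMn -mulr_natl h_half.
rewrite /H (derivation_hamiltonian (D := mderiv i)).
- by rewrite two_h mul1r /= !mderiv_var.
- exact: mderivM.
- exact: mderivC.
- exact: mderivC.
- exact: mderivC.
- exact: mderivC.
Qed.

Definition poisson f g : {mpoly S[4]} :=
  f^`M(ix) * g^`M(iy) - f^`M(iy) * g^`M(ix)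
  + f^`M(iz) * g^`M(iw) - f^`M(iw) * g^`M(iz).

Lemma sum_hamiltonian_field f g :
  \sum_(i < 4) f^`M(i) * tnth [tuple g^`M(iy); - g^`M(ix); g^`M(iw); - g^`M(iz)] i
  = poisson f g.
Proof.
rewrite !big_ord_recl big_ord0 !(tnth_nth 0) /= addr0.
have -> : ord0 = ix by apply/val_inj.
have -> : lift ix (ord0 : 'I_3) = iy by apply/val_inj.
have -> : lift ix (lift ord0 (ord0 : 'I_2)) = iz by apply/val_inj.
have -> : lift ix (lift ord0 (lift ord0 (ord0 : 'I_1))) = iw by apply/val_inj.
by rewrite /poisson !mulrN !addrA.
Qed.

Let mderivEs := (mderivD, mderivM, mderivC, mderiv_var).

Lemma poisson_w : a0 = 0 -> poisson w H = - (2 * y + 2 * z) * w.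
Proof.
by move=> a0_0; rewrite /poisson !mderiv_hamiltonian !mderivEs a0_0 mpolyC0 /=; ring.
Qed.

Lemma poisson_xDz2 :
  a1 = 0 -> poisson (x + z ^+ 2) H = (4 * y + 2 * z) * (x + z ^+ 2).
Proof.
(* Squares are opened only under a derivative, to let the product rule apply. *)
move=> a1_0; rewrite /poisson !mderiv_hamiltonian ![in _^`M(_)]expr2 !mderivEs.
by rewrite a1_0 mpolyC0 /=; ring.
Qed.

(** The summand 1 stands for the time derivative of [t], which the bracket does not see; it cancels
    the remainder [a0 + 2 * a1]. *)
Lemma poisson_xDy2DwDt : a0 + 2 * a1 = 1 ->
  1 + poisson (x + y ^+ 2 + w + t%:MP) H = - (4 * y) * (x + y ^+ 2 + w + t%:MP).
Proof.
move=> sum1.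
have <- : - (4 * y) * (x + y ^+ 2 + w + t%:MP) - (a0%:MP + 2 * a1%:MP) =
          poisson (x + y ^+ 2 + w + t%:MP) H.
  by rewrite /poisson !mderiv_hamiltonian ![in _^`M(_)]expr2 !mderivEs /=; ring.
have -> : a0%:MP_[4] + 2 * a1%:MP = 1.
  by rewrite mulr_natl -mpolyCMn -mpolyCD -mulr_natl sum1.
by rewrite addrC subrK.
Qed.

End GenericCoefficients.

(** Additivity of the quotient rule is a pure field identity once the derivatives are replaced by
    independent symbols. *)
Lemma quotient_ruleB (K : fieldType) (p q p' q' dp dq dp' dq' : K) :
  q != 0 -> q' != 0 ->
  ((dp * q' + p * dq' - (dp' * q + p' * dq)) * (q * q')
     - (p * q' - p' * q) * (dq * q' + q * dq')) / (q * q') ^+ 2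
  = (dp * q - p * dq) / q ^+ 2 - (dp' * q' - p' * dq') / q' ^+ 2.
Proof. by move=> q0 q'0; field; rewrite q0 q'0. Qed.

Section RationalFunctionDerivation.
Variable F : fieldType.
Implicit Types (p q : {poly F}) (a b : {fraction {poly F}}).

Lemma ratfun_quotient a : exists p q, q != 0 /\ a = p%:F / q%:F.
Proof.
exists \n_(repr a), \d_(repr a).
have d0 : \d_(repr a) != 0 by exact: denom_ratioP.
split=> //; apply: (canRL (mulfK _)); first by rewrite tofrac_eq0.
(* Both sides become classes of explicit pairs, whose equality is cross-multiplication. *)
rewrite -{1}[a]reprK; unlock FracField.tofrac.
rewrite -[LHS]FracField.pi_mul; apply/eqmodP.
rewrite /= FracField.equivfE /FracField.mulf.
by rewrite !(numden_Ratio, mulr1, oner_neq0) // mulrC.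
Qed.

(** Additivity is what makes the lemmas on [map_mpoly] available for [time_deriv]. *)
Lemma ratfun_deriv_is_additive : zmod_morphism (@ratfun_deriv F).
Proof.
move=> a b.
have [p [q [q0 ->]]] := ratfun_quotient a.
have [p' [q' [q'0 ->]]] := ratfun_quotient b.
have qF : q%:F != 0 by rewrite tofrac_eq0.
have q'F : q'%:F != 0 by rewrite tofrac_eq0.
have -> : p%:F / q%:F - p'%:F / q'%:F = (p * q' - p' * q)%:F / (q * q')%:F.
  by rewrite -mulNr (addf_div _ _ qF q'F) mulNr -!tofracM -tofracB.
rewrite !ratfun_derivE ?mulf_neq0 // derivB !derivM.
rewrite !(tofracB, tofracD, tofracM, tofracXn).
by rewrite (quotient_ruleB _ _ _ _ _ _ qF q'F).
Qed.

HB.instance Definition _ :=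
  GRing.isZmodMorphism.Build {fraction {poly F}} {fraction {poly F}}
    (@ratfun_deriv F) ratfun_deriv_is_additive.

Lemma ratfun_deriv_tofrac p : ratfun_deriv p%:F = (p^`())%:F.
Proof.
have -> : p%:F = p%:F / 1%:F by rewrite tofrac1 divr1.
by rewrite ratfun_derivE ?oner_eq0 // derivE mulr0 subr0 mulr1 expr1n tofrac1 divr1.
Qed.

Lemma time_derivD : {morph @time_deriv F : f g / f + g}.
Proof. by move=> f g; rewrite /time_deriv raddfD. Qed.

Lemma time_derivX m : time_deriv ('X_[m] : phase_poly F) = 0.
Proof.
apply/mpolyP=> k; rewrite /time_deriv mcoeff_map_mpoly mcoeffX mcoeff0.
(* A coefficient of a monomial is 0 or 1, hence the image of a constant polynomial. *)
by rewrite -tofrac1 -tofracMn /= ratfun_deriv_tofrac derivMn derivE mul0rn tofrac0.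
Qed.

Lemma time_deriv_t : time_deriv (time_t F) = 1.
Proof. by rewrite /time_deriv map_mpolyC /= ratfun_deriv_tofrac derivX tofrac1. Qed.

Lemma time_deriv_xDz2 : time_deriv (var_x F + var_z F ^+ 2) = 0.
Proof. by rewrite time_derivD mpolyXn !time_derivX addr0. Qed.

Lemma time_deriv_xDy2DwDt :
  time_deriv (var_x F + var_y F ^+ 2 + var_w F + time_t F) = 1.
Proof.
have xDy2Dw : time_deriv (var_x F + var_y F ^+ 2 + var_w F) = 0.
  by rewrite !time_derivD mpolyXn !time_derivX !addr0.
(* An explicit term avoids pattern search over the fraction field. *)
rewrite time_derivD; exact: etrans (congr2 +%R xDy2Dw time_deriv_t) (add0r 1).
Qed.

Lemma const_ratfun0 : (0%:P)%:F = 0 :> {fraction {poly F}}.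
Proof. by rewrite polyC0 tofrac0. Qed.

(** Used twice: for the normalization of the parameters when [a2] vanishes, and with [a = 0],
    [b = 2^-1] for the hypothesis [h_half]. *)
Lemma const_ratfun_sum (a b : F) :
  a + 2 * b = 1 -> (a%:P)%:F + 2 * (b%:P)%:F = 1 :> {fraction {poly F}}.
Proof.
move=> sum1; rewrite mulr_natl -tofracMn -polyCMn -tofracD -polyCD.
by rewrite -(mulr_natl b) sum1 polyC1 tofrac1.
Qed.

Lemma total_derivE (H f : phase_poly F) :
  total_deriv (hamiltonian_field H) f = time_deriv f + poisson f H.
Proof. by rewrite /total_deriv /hamiltonian_field sum_hamiltonian_field. Qed.

End RationalFunctionDerivation.

Theorem proposition2p2 (R : realType) (a0 a1 a2 : R[i])
    (Ha : a0 + 2 * a1 + 2 * a2 = 1) :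
  let x := var_x R[i] in let y := var_y R[i] in
  let z := var_z R[i] in let w := var_w R[i] in
  let t := time_t R[i] in
  let v := hamiltonian_field (hamiltonian a0 a1) in
  [/\ a0 = 0 -> invariant_divisor v w,
      a1 = 0 -> invariant_divisor v (x + z ^+ 2)
    & a2 = 0 -> invariant_divisor v (x + y ^+ 2 + w + t)].
Proof.
move=> x y z w t v.
have half : 2 * (2^-1%:P)%:F = 1 :> {fraction {poly R[i]}}.
  rewrite -[LHS]add0r -const_ratfun0; apply: const_ratfun_sum.
  by rewrite add0r divff // Num.Theory.pnatr_eq0.
split=> a_eq0; rewrite /invariant_divisor /v total_derivE.
- exists (- (2 * y + 2 * z)); rewrite time_derivX add0r.
  by apply: (poisson_w _ _ half); rewrite a_eq0; exact: const_ratfun0.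
- exists (4 * y + 2 * z).
  rewrite time_deriv_xDz2 add0r.
  by apply: (poisson_xDz2 _ _ half); rewrite a_eq0; exact: const_ratfun0.
- exists (- (4 * y)).
  rewrite time_deriv_xDy2DwDt.
  apply: (poisson_xDy2DwDt _ half); apply: const_ratfun_sum.
  by rewrite -[RHS]Ha a_eq0 mulr0 addr0.
Qed.
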